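(* Let $b\geq 2$ and $l\geq 2$ be two integers, and let $G$ be a connected graph of order $n$ with $n\geq 6b\left\lceil\frac{l-1}{b}\right\rceil$. If $$q(G)\geq q\big(K_{\lfloor\frac{l-1}{b}\rfloor}\vee(K_{n-\lfloor\frac{l-1}{b}\rfloor-l+1}\cup(l-1)K_1)\big),$$ then $t_{l}(G)\geq\frac{1}{b}$, unless $G=K_{\lfloor\frac{l-1}{b}\rfloor}\vee(K_{n-\lfloor\frac{l-1}{b}\rfloor-l+1}\cup(l-1)K_1)$.
   Context: All graphs are finite, undirected and simple; equality of graphs means isomorphism. The order of a graph is its number of vertices. $K_m$ is the complete graph on $m$ vertices ($K_0$ is the graph with no vertices, so that $K_0\vee H=H$), $G_1\cup G_2$ is the disjoint union of graphs, $tG_1$ is the disjoint union of $t$ copies of $G_1$, and the join $G_1\vee G_2$ is obtained from $G_1\cup G_2$ by adding all edges between $V(G_1)$ and $V(G_2)$. The signless Laplacian matrix of $G$ is $Q(G)=D(G)+A(G)$, where $A(G)$ is the adjacency matrix and $D(G)$ is the diagonal matrix of vertex degrees. The $Q$-index $q(G)$ is the largest eigenvalue of $Q(G)$. Let $c(H)$ denote the number of connected components of a graph $H$ and $\alpha(G)$ the independence number of $G$. For an integer $l\geq2$, the $l$-toughness of $G$ is $$t_l(G)=\min\left\{\frac{|S|}{c(G-S)}:S\subset V(G),\ c(G-S)\geq l\right\}\quad\text{if } 2\leq l\leq\alpha(G),$$ and $t_l(G)=+\infty$ if $l>\alpha(G)$. Here $G-S$ is the subgraph of $G$ induced by $V(G)\setminus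 S$. *)

(* Defs.v *)
From HB Require Import structures.
From mathcomp Require Import all_boot all_order all_algebra.
From mathcomp Require Import all_classical all_reals.
From mathcomp Require Import complex polyrcf.

Set Implicit Arguments.
Unset Strict Implicit.
Unset Printing Implicit Defensive.

Import Order.TTheory GRing.Theory Num.Theory.

Local Open Scope ring_scope.

Record sgraph := SGraph {
  vertex :> finType;
  edge : rel vertex;
  edge_sym : symmetric edge;
  edge_irr : irreflexive edge
}.

Definition isomorphic (G H : sgraph) : Prop :=
  exists f : G -> H, bijective f /\ forall x y, edge (f x) (f y) = edge x y.

(* n_comp counts the classes of the reflexive transitive closure of edge. *)
Definition ncomponents (G : sgraph) : nat := n_comp (@edge G) [set: G]%SET.

Definition connected_graph (G : sgraph) : Prop :=
  forall x y : G, connect (@edge G) x y.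

Definition complete_edge m : rel 'I_m := fun x y => x != y.

Lemma complete_sym m : symmetric (@complete_edge m).
Proof. by move=> x y; rewrite /complete_edge eq_sym. Qed.

Lemma complete_irr m : irreflexive (@complete_edge m).
Proof. by move=> x; rewrite /complete_edge eqxx. Qed.

Definition complete_graph m : sgraph := SGraph (@complete_sym m) (@complete_irr m).

Section Constructions.
Variables G H : sgraph.

Definition disjoint_union_edge : rel (G + H)%type := fun u v =>
  match u, v with
  | inl x, inl y => edge x y
  | inr x, inr y => edge x y
  | _, _ => false
  end.

Lemma disjoint_union_sym : symmetric disjoint_union_edge.
Proof. by move=> [x|x] [y|y] //=; rewrite edge_sym. Qed.

Lemma disjoint_union_irr : irreflexive disjoint_union_edge.
Proof. by move=> [x|x] /=; rewrite edge_irr. Qed.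

Definition disjoint_union : sgraph :=
  SGraph disjoint_union_sym disjoint_union_irr.

Definition join_edge : rel (G + H)%type := fun u v =>
  match u, v with
  | inl x, inl y => edge x y
  | inr x, inr y => edge x y
  | _, _ => true
  end.

Lemma join_sym : symmetric join_edge.
Proof. by move=> [x|x] [y|y] //=; rewrite edge_sym. Qed.

Lemma join_irr : irreflexive join_edge.
Proof. by move=> [x|x] /=; rewrite edge_irr. Qed.

Definition join_graph : sgraph := SGraph join_sym join_irr.

Definition copies_edge t : rel ('I_t * G)%type :=
  fun u v => (u.1 == v.1) && edge u.2 v.2.

Lemma copies_sym t : symmetric (@copies_edge t).
Proof. by move=> u v; rewrite /copies_edge eq_sym edge_sym. Qed.

Lemma copies_irr t : irreflexive (@copies_edge t).
Proof. by move=> u; rewrite /copies_edge edge_irr andbF. Qed.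

Definition copies t : sgraph := SGraph (@copies_sym t) (@copies_irr t).

Definition induced_edge (A : {set G}) : rel {x : G | x \in A} :=
  fun u v => edge (val u) (val v).

Lemma induced_sym A : symmetric (@induced_edge A).
Proof. by move=> u v; rewrite /induced_edge edge_sym. Qed.

Lemma induced_irr A : irreflexive (@induced_edge A).
Proof. by move=> u; rewrite /induced_edge edge_irr. Qed.

Definition induced (A : {set G}) : sgraph :=
  SGraph (@induced_sym A) (@induced_irr A).

Definition delete_vertices (S : {set G}) : sgraph := induced (~: S)%SET.

Definition independent (A : {set G}) : bool :=
  [forall x in A, forall y in A, ~~ edge x y].

Definition independence_number : nat :=
  \max_(A : {set G} | independent A) #|A|.

Definition degree (x : G) : nat := #|[set y | edge x y]%SET|.

End Constructions.

Section SignlessLaplacian.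
Variables (R : realType) (G : sgraph).

Definition adjacency_mx : 'M[R]_#|G| :=
  \matrix_(i, j) (edge (enum_val i) (enum_val j))%:R.

Definition degree_mx : 'M[R]_#|G| :=
  diag_mx (\row_i (degree (enum_val i))%:R).

Definition signless_laplacian : 'M[R]_#|G| := degree_mx + adjacency_mx.

(* The supremum is a maximum when G has a vertex: see q_index_largest. *)
Definition q_index : R := sup [set a : R | eigenvalue signless_laplacian a].

End SignlessLaplacian.

Lemma q_index_largest (R : realType) (G : sgraph) : (0 < #|G|)%N ->
  eigenvalue (signless_laplacian R G) (q_index R G) /\
  forall a, eigenvalue (signless_laplacian R G) a -> a <= q_index R G.
Proof.
move=> G_gt0; set A := signless_laplacian R G.
have symA i j : A i j = A j i.
  rewrite !mxE edge_sym; case: (eqVneq i j) => [->|_] //.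
have [a Aa] : exists a, eigenvalue A a.
  pose C : numClosedFieldType := complex R.
  pose B : 'M[C]_#|G| := map_mx (real_complex R) A.
  have hB : B \is hermsymmx.
    apply: realsym_hermsym.
      apply/is_hermitianmxP; rewrite expr0 scale1r; apply/matrixP => i j.
      by rewrite [LHS]mxE [RHS]mxE [in RHS]mxE [in RHS]mxE symA.
    by apply/mxOverP => i j; rewrite mxE; apply/complex_realP; exists (A i j).
  have /orthomx_spectralP eqB := hermitian_normalmx hB.
  have /mxOverP dR := hermitian_spectral_diag_real hB.
  pose i := Ordinal G_gt0.
  have /complex_realP [r dr] := dR ord0 i.
  exists r; rewrite -(eigenvalue_map (real_complex R)) -/B.
  apply/eigenvalueP; exists (row i (spectralmx B)).
    rewrite -row_mul {2}eqB !mulmxA mulmxV ?spectral_unit// mul1mx.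
    by rewrite row_mul row_diag_mx -scalemxAl -rowE dr.
  apply: contraNneq (oner_neq0 C) => rP0.
  have : row i (spectralmx B) *m invmx (spectralmx B) = row i 1%:M.
    by rewrite -row_mul mulmxV ?spectral_unit.
  by rewrite rP0 mul0mx => /rowP/(_ i); rewrite !mxE eqxx => /eqP; rewrite eq_sym.
have pA0 : char_poly A != 0 by rewrite monic_neq0 ?char_poly_monic.
have memA b : eigenvalue A b = (b \in rootsR (char_poly A)).
  by rewrite eigenvalue_root_char -(roots_on_rootsR pA0).
set s := rootsR _ in memA.
have [m ms mmax] : exists2 m, m \in s & {in s, forall b, b <= m}.
  rewrite memA in Aa; exists (\big[Order.max/a]_(b <- s) b).
    by rewrite big_seq; elim/big_ind: _ => // x y xs ys; case: leP.
  by move=> b bs; apply: le_bigmax_seq.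
have mem_set b : [set a | eigenvalue A a]%classic b -> b <= m.
  by rewrite /= memA; apply: mmax.
suff -> : q_index R G = m by rewrite memA; split=> // b; rewrite memA; apply: mmax.
apply/eqP; rewrite eq_le /q_index; apply/andP; split.
  by apply: ge_sup; [exists a | move=> b /mem_set].
by apply: ub_le_sup; [exists m => b /mem_set | rewrite /= memA].
Qed.

(* When l <= independence_number G, deleting the complement of a maximum
   independent set shows that the minimum is over a nonempty family; +oo is
   only its neutral element. *)
Definition toughness (R : realType) (l : nat) (G : sgraph) : \bar R :=
  if (l <= independence_number G)%N then
    \big[Order.min/+oo%E]_(S : {set G}
        | (l <= ncomponents (delete_vertices S))%N)
      (#|S|%:R / (ncomponents (delete_vertices S))%:R)%:E
  else +oo%E.

Definition ceil_div (m d : nat) : nat := (m %/ d + ~~ (d %| m))%N.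

Lemma ceil_divE (R : archiRealFieldType) (m d : nat) : (0 < d)%N ->
  (ceil_div m d)%:Z = Num.ceil (m%:R / d%:R : R).
Proof.
move=> d0; apply/esym/ceil_def.
have dR : 0 < d%:R :> R by rewrite ltr0n.
rewrite ltr_pdivlMr// ler_pdivrMr// intrB -pmulrn mulrBl mul1r ltrBlDr.
rewrite -natrM -natrD ltr_nat ler_nat /ceil_div /dvdn.
have := divn_eq m d; have := ltn_pmod m d0.
case: eqP => /= [->|].
  by rewrite !addn0 => _ <-; rewrite leqnn andbT -addn1 leq_add2l.
move=> /eqP; rewrite -lt0n; move: (m %/ d)%N (m %% d)%N => q r r0 r1 ->.
rewrite addn1 mulSn [(d + _)%N]addnC ltn_add2r leq_add2l (ltnW r1) andbT.
by rewrite -[ltnLHS]addn0 ltn_add2l.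
Qed.

Definition extremal_graph (n l b : nat) : sgraph :=
  let s := ((l - 1) %/ b)%N in
  join_graph (complete_graph s)
    (disjoint_union (complete_graph (n - s - l + 1)%N)
       (copies (complete_graph 1%N) (l - 1)%N)).

(* Main.v *)
(* Let p = l - 1 and s0 = floor(p / b), and suppose S violates the toughness
   bound: G - S has c >= l components and b |S| < c.  Let f be the Perron vector
   of G and w a vertex outside S maximising f.  Isolate one vertex in each of
   any chosen components of G - S not containing w, and join all other pairs of
   vertices except those within the isolated set or between it and the rest
   outside S: a lost edge uv, with v isolated, is paid for by the new edge uw.
   So q(G) <= q(F), where F is the split graph
   K_s v (K_{n-s-p'} u p' K_1) for any p' < c, with s = |S|.
   If s <= s0, take p' = p and enlarge S to s0 vertices: q(G) <= q(H) for the
   extremal graph H, and equality makes f an eigenvector of both matrices, so no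
   edge was gained at w, hence none was lost and G = H.
   If s > s0, take p' = b s.  The Perron vector of F takes three values x, y, z;
   if q(H) <= q(F), testing it in the Rayleigh quotient of H contradicts the
   eigenvalue equations together with q(F) >= q(H) >= 2 (n - 1 - p) and
   n >= 6 p. *)

Require Import Defs.
From mathcomp Require Import all_boot all_order all_algebra.
From mathcomp Require Import all_classical all_reals.
From mathcomp Require Import complex.
From mathcomp Require Import ring lra zify.
Import Order.TTheory GRing.Theory Num.Theory.
Local Open Scope ring_scope.

(** * Rayleigh quotients and Perron vectors *)

(** Over the complex extension of [R] the matrix is Hermitian and the spectral theorem applies: in
    the coordinates [w] of an orthonormal eigenbasis the form is the sum of d_i |w_i|^2, and each
    d_i is a real eigenvalue of [A]. *)
Lemma symmetric_rayleigh (R : realType) (n : nat) (A : 'M[R]_n) (q : R) :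
  (forall i j, A i j = A j i) -> (forall a, eigenvalue A a -> a <= q) ->
  forall v : 'rV[R]_n, (v *m A *m v^T) 0 0 <= q * (v *m v^T) 0 0.
Proof.
move=> symA q_max v.
pose C : numClosedFieldType := complex R.
pose B : 'M[C]_n := map_mx (real_complex R) A.
have hB : B \is hermsymmx.
  apply: realsym_hermsym.
    apply/is_hermitianmxP; rewrite expr0 scale1r; apply/matrixP => i j.
    by rewrite [LHS]mxE [RHS]mxE [in RHS]mxE [in RHS]mxE symA.
  by apply/mxOverP => i j; rewrite mxE; apply/complex_realP; exists (A i j).
have /orthomx_spectralP := hermitian_normalmx hB.
have /mxOverP := hermitian_spectral_diag_real hB.
have := spectral_unitarymx B.
set P := spectralmx B; set d := spectral_diag B => uP dR eqB.
have Pu : P \in unitmx by exact: unitarymx_unit.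
pose V : 'rV[C]_n := map_mx (real_complex R) v.
pose w := V *m invmx P.
have VT : map_mx Num.conj (V^T) = V^T.
  apply/matrixP => i j; rewrite !mxE; apply/CrealP.
  by apply/complex_realP; exists (v j i).
have PV : P *m V^T = map_mx Num.conj (w^T).
  rewrite /w invmx_unitary // trmx_mul map_mxM VT; congr (_ *m _).
  by apply/matrixP => i j; rewrite !mxE /= conjCK.
have formE (M : 'M[R]_n) :
    ((v *m M *m v^T) 0 0)%:C%C = (V *m map_mx (real_complex R) M *m V^T) 0 0.
  by rewrite /V map_trmx -!map_mxM [in RHS]mxE.
have := formE 1%:M; rewrite mulmx1 map_mx1 mulmx1 => vvE.
rewrite -lecR (rmorphM (real_complex R)) /= vvE formE -/B.
have -> : V *m V^T = w *m map_mx Num.conj (w^T).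
  by rewrite -PV /w mulmxA mulmxKV.
rewrite {1}eqB.
have -> : V *m (invmx P *m diag_mx d *m P) *m V^T
        = w *m diag_mx d *m map_mx Num.conj (w^T).
  by rewrite -PV /w !mulmxA.
rewrite mxE [X in _ <= _ * X]mxE mulr_sumr; apply: ler_sum => i _.
rewrite mul_mx_diag !mxE mulrAC -normCK mulrC ler_wpM2r ?exprn_ge0 //.
have /complex_realP [r dr] := dR ord0 i.
rewrite dr lecR; apply: q_max.
rewrite -(eigenvalue_map (real_complex R)) -/B.
apply/eigenvalueP; exists (row i P).
  rewrite -row_mul {1}eqB !mulmxA mulmxV // mul1mx.
  by rewrite row_mul row_diag_mx -scalemxAl -rowE dr.
apply: contraNneq (oner_neq0 C) => rP0.
have : row i P *m invmx P = row i 1%:M by rewrite -row_mul mulmxV.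
by rewrite rP0 mul0mx => /rowP/(_ i); rewrite !mxE eqxx => /eqP; rewrite eq_sym.
Qed.

(** The signless Laplacian acting on functions on the vertices, free of the enumeration used by the
    matrix; [signless_mx] links the two. *)
Definition signless {R : realType} (G : sgraph) (f : G -> R) (u : G) : R :=
  \sum_v (edge u v)%:R * (f u + f v).

Definition quadratic_form {R : realType} (G : sgraph) (f : G -> R) : R :=
  \sum_u f u * signless G f u.

Section QuadraticForm.
Context {R : realType}.
Implicit Types (G H : sgraph) (q : R).

(** Each edge occurs as two ordered pairs, whence the factor 2. *)
Lemma quadratic_form_edges G (f : G -> R) :
  2 * quadratic_form G f = \sum_u \sum_v (edge u v)%:R * (f u + f v) ^+ 2.
Proof.
rewrite mulr_natl mulr2n /quadratic_form.
have E : \sum_u f u * signless G f u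
       = \sum_u \sum_v (edge u v)%:R * (f u * (f u + f v)).
  by apply: eq_bigr => u _; rewrite mulr_sumr; apply: eq_bigr => v _; ring.
rewrite {1}E exchange_big E -big_split /=; apply: eq_bigr => u _.
rewrite -big_split /=; apply: eq_bigr => v _.
by rewrite [edge v u]edge_sym; ring.
Qed.

Lemma quadratic_form_le_abs G (f : G -> R) :
  quadratic_form G f <= quadratic_form G (fun u => `|f u|).
Proof.
rewrite -(ler_pM2l (_ : 0 < 2 :> R)) // !quadratic_form_edges.
apply: ler_sum => u _; apply: ler_sum => v _; apply: ler_wpM2l => //.
rewrite -[leLHS]ger0_norm ?sqr_ge0 // normrX lerXn2r ?nnegrE ?addr_ge0 //.
exact: ler_normD.
Qed.

Lemma signless_mx G (v : 'rV[R]_#|G|) i :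
  (v *m signless_laplacian R G) 0 i
  = signless G (fun u => v 0 (enum_rank u)) (enum_val i).
Proof.
rewrite mxE /signless (eq_bigr (fun j => v 0 j * (degree (enum_val j))%:R *
  (j == i)%:R + v 0 j * (edge (enum_val j) (enum_val i))%:R)); last first.
  by move=> j _; rewrite !mxE mulrDr; case: (eqVneq j i) => _;
     rewrite ?mulr1n ?mulr0n ?mulr1 ?mulr0.
rewrite big_split /= (bigD1 i) //= eqxx mulr1 big1 ?addr0; last first.
  by move=> j /negPf ->; rewrite mulr0.
under [RHS]eq_bigr do rewrite mulrDr; rewrite big_split /=; congr (_ + _).
  rewrite enum_valK -mulr_suml mulrC; congr (_ * _).
  rewrite /degree -sum1_card natr_sum big_mkcond /=.
  by apply: eq_bigr => u _; rewrite inE; case: edge.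
rewrite (reindex enum_rank) /=; last exact/onW_bij/enum_rank_bij.
by apply: eq_bigr => u _; rewrite enum_rankK edge_sym mulrC.
Qed.

Lemma q_index_rayleigh G (f : G -> R) :
  quadratic_form G f <= q_index R G * \sum_u f u ^+ 2.
Proof.
have [G0|G_gt0] := posnP #|G|.
  have noG (u : G) : false by have := fintype0 u G0.
  by rewrite /quadratic_form !big1 ?mulr0 // => u; have := noG u.
have [_ q_max] := q_index_largest R G_gt0.
pose v : 'rV[R]_#|G| := \row_i f (enum_val i).
have symQ i j : signless_laplacian R G i j = signless_laplacian R G j i.
  by rewrite !mxE edge_sym; case: (eqVneq i j) => [->|_].
have := symmetric_rayleigh _ _ _ _ symQ q_max v.
rewrite mxE [X in _ <= _ * X -> _]mxE.
rewrite (reindex enum_rank) /=; last exact/onW_bij/enum_rank_bij.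
rewrite [X in _ <= _ * X -> _](reindex enum_rank) /=; last first.
  exact/onW_bij/enum_rank_bij.
congr (_ <= _ * _); apply: eq_bigr => u _; last by rewrite !mxE enum_rankK.
rewrite signless_mx !mxE !enum_rankK mulrC; congr (_ * _).
by apply: eq_bigr => w _; rewrite !mxE !enum_rankK.
Qed.

Lemma eq0_of_quadratic_ge0 (a c : R) :
  (forall t, 0 <= 2 * t * a + t ^+ 2 * c) -> a = 0.
Proof.
move=> h; apply/eqP; apply: contraT => a0.
have c1 : 0 < `|c| + 1 by rewrite ltr_pwDr.
(* At this t the linear term outweighs the quadratic one: the value is a^2 / (|c| + 1)^2 times a
   negative number. *)
have := h (- a / (`|c| + 1)).
have -> : 2 * (- a / (`|c| + 1)) * a + (- a / (`|c| + 1)) ^+ 2 * c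
  = a ^+ 2 / (`|c| + 1) ^+ 2 * (c - 2 * `|c| - 2).
  by field; rewrite gt_eqF.
rewrite pmulr_rge0; last by rewrite divr_gt0 ?exprn_even_gt0 //= ?a0 ?gt_eqF.
have := ler_norm c; have := normr_ge0 c; lra.
Qed.

(* A maximiser of the Rayleigh quotient is an eigenvector: perturb it in one
   coordinate. *)
Lemma rayleigh_eq_eigen G (f : G -> R) :
  quadratic_form G f = q_index R G * \sum_u f u ^+ 2 ->
  forall u, signless G f u = q_index R G * f u.
Proof.
set q := q_index R G => fq w.
apply/eqP; rewrite eq_sym -subr_eq0; apply/eqP.
apply: (@eq0_of_quadratic_ge0 _ (q - \sum_v (edge w v)%:R)) => t.
pose g u := f u + t * (u == w)%:R.
have gsq : \sum_u g u ^+ 2 = \sum_u f u ^+ 2 + (2 * t * f w + t ^+ 2).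
  rewrite (bigD1 w) //= [\sum_u f u ^+ 2](bigD1 w) //= /g eqxx.
  rewrite (eq_bigr (fun u => f u ^+ 2)); last first.
    by move=> u /negPf ->; rewrite mulr0 addr0.
  by rewrite /=; ring.
have gsl u : signless G g u = signless G f u
    + t * (u == w)%:R * \sum_v (edge w v)%:R + t * (edge u w)%:R.
  rewrite /signless.
  have -> : t * (edge u w)%:R = \sum_v (edge u v)%:R * (t * (v == w)%:R).
    rewrite (bigD1 w) //= eqxx big1 ?addr0 ?mulr1 1?mulrC // => v /negPf ->.
    by rewrite !mulr0.
  rewrite mulr_sumr -!big_split /=; apply: eq_bigr => v _; rewrite /g.
  by case: (eqVneq u w) => [->|_] /=; ring.
have gqf : quadratic_form G g = quadratic_form G f
    + 2 * t * signless G f w + t ^+ 2 * \sum_v (edge w v)%:R.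
  rewrite /quadratic_form.
  rewrite (eq_bigr (fun u => f u * signless G f u
    + (u == w)%:R * (t * signless G f w + t * f w * \sum_v (edge w v)%:R
       + t ^+ 2 * \sum_v (edge w v)%:R) + t * (f u * (edge u w)%:R))); last first.
    move=> u _; rewrite gsl /g; case: (eqVneq u w) => [->|_] /=; last by ring.
    by rewrite edge_irr /=; ring.
  rewrite !big_split /= -mulr_sumr -mulr_suml.
  have -> : \sum_u (u == w)%:R = 1 :> R.
    by rewrite (bigD1 w) //= eqxx big1 ?addr0 // => u /negPf ->.
  have -> : signless G f w = f w * \sum_v (edge w v)%:R + \sum_u f u * (edge u w)%:R.
    rewrite mulr_sumr -big_split /=; apply: eq_bigr => v _.
    by rewrite [edge v w]edge_sym; ring.
  by ring.
have := q_index_rayleigh G g; rewrite gqf gsq fq -/q -subr_ge0.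
by congr (0 <= _); ring.
Qed.

(** Taking absolute values preserves the norm and does not decrease the quadratic form, so it turns
    an eigenvector for the index into a maximiser of the Rayleigh quotient, hence again into an
    eigenvector. *)
Lemma perron_vector G : (0 < #|G|)%N ->
  exists f : G -> R, [/\ forall u, 0 <= f u, exists u, f u != 0
    & forall u, signless G f u = q_index R G * f u].
Proof.
move=> G_gt0; have [/eigenvalueP[v vq v0] _] := q_index_largest R G_gt0.
pose f u := v 0 (enum_rank u).
have fq u : signless G f u = q_index R G * f u.
  have := congr1 (fun M : 'rV_#|G| => M 0 (enum_rank u)) vq.
  by rewrite /= signless_mx enum_rankK mxE.
exists (fun u => `|f u|); split=> //.
- apply/existsP; apply: contraR v0 => /existsPn f0.
  apply/eqP/rowP => i; rewrite mxE; have := f0 (enum_val i).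
  by rewrite negbK normr_eq0 /f enum_valK => /eqP.
- apply: rayleigh_eq_eigen; apply/le_anti/andP; split.
    exact: q_index_rayleigh.
  apply: le_trans (quadratic_form_le_abs _ _).
  rewrite /quadratic_form mulr_sumr; apply: ler_sum => u _.
  by rewrite fq real_normK ?num_real // expr2 mulrCA.
Qed.

(** At a zero of f the eigenvalue equation is a vanishing sum of nonnegative terms, so f vanishes at
    every neighbour and, along paths, everywhere. *)
Lemma perron_vector_gt0 G (f : G -> R) q : connected_graph G ->
  (forall u, 0 <= f u) -> (exists u, f u != 0) ->
  (forall u, signless G f u = q * f u) -> forall u, 0 < f u.
Proof.
move=> Gconn f_ge0 [w fw] fq u; rewrite lt_neqAle f_ge0 andbT eq_sym.
apply: contraNneq fw => fu; apply/eqP.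
have /connectP[p] := Gconn u w.
elim: p u fu => [|v p IH] u fu /= => [_ ->//|/andP[uv pv] wl].
apply: (IH v) => //; have := fq u; rewrite fu mulr0 => /eqP.
rewrite psumr_eq0 => [/allP/(_ v (mem_index_enum v))|x _].
  by rewrite /= uv mul1r fu add0r => /eqP.
by rewrite mulr_ge0 // addr_ge0.
Qed.

Lemma q_index_hom_le G (H : sgraph) (h : G -> H) : (0 < #|G|)%N -> bijective h ->
  (forall u v, edge u v -> edge (h u) (h v)) -> q_index R G <= q_index R H.
Proof.
move=> G_gt0 hbij hom.
have [f [f_ge0 [w fw] fq]] := perron_vector G G_gt0.
have [h' hK h'K] := hbij.
have sq_gt0 : 0 < \sum_u f u ^+ 2.
  rewrite (bigD1 w) //= ltr_pwDl //; last by apply: sumr_ge0 => u _; exact: sqr_ge0.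
  by rewrite exprn_even_gt0.
have := q_index_rayleigh H (f \o h').
rewrite [X in _ <= _ * X](reindex h) /=; last exact: onW_bij.
under eq_bigr do rewrite hK.
apply: contraTT; rewrite -!ltNge => qlt.
apply: lt_le_trans (_ : quadratic_form G f <= _).
  rewrite [ltRHS](eq_bigr (fun u => q_index R G * f u ^+ 2)).
    by rewrite -[ltRHS]mulr_sumr ltr_pM2r.
  by move=> u _; rewrite fq; ring.
rewrite -(ler_pM2l (_ : 0 < 2 :> R)) // !quadratic_form_edges.
rewrite [leRHS](reindex h) /=; last exact: onW_bij.
apply: ler_sum => u _; rewrite [leRHS](reindex h) /=; last exact: onW_bij.
apply: ler_sum => v _; rewrite !hK ler_wpM2r ?sqr_ge0 // ler_nat.
by case: (boolP (edge u v)) => // /hom ->.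
Qed.

End QuadraticForm.

(** * Split graphs *)

Section SplitGraph.
Context {V : finType}.
Variables S I : {set V}.

(** For disjoint S and I this is K_s v (K_{n-s-p} u p K_1) with s = |S| and p = |I|, placed on a
    given vertex set so that it can be compared with G edge by edge. *)
Definition split_edge : rel V := fun u v =>
  (u != v) && [|| u \in S, v \in S | (u \notin I) && (v \notin I)].

Lemma split_edge_sym : symmetric split_edge.
Proof.
by move=> u v; rewrite /split_edge eq_sym orbCA [(u \notin I) && _]andbC.
Qed.

Lemma split_edge_irr : irreflexive split_edge.
Proof. by move=> u; rewrite /split_edge eqxx. Qed.

Definition split_graph : sgraph := SGraph split_edge_sym split_edge_irr.

End SplitGraph.

(** [c] labels a vertex outside S by the root of its component, its value on S being a dummy; I
    consists of roots. The root of the component of w is given up, whence the strict inequality on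
    p. *)
Lemma component_transversal (G : sgraph) (S : {set G}) (p : nat) (w : G) :
  (p < ncomponents (delete_vertices S))%N -> w \notin S ->
  exists (I : {set G}) (c : G -> G), [/\ #|I| = p, [disjoint I & S],
    forall u v, u \notin S -> v \notin S -> edge u v -> c u = c v,
    {in I &, injective c} & forall v, v \in I -> c v != c w].
Proof.
move=> p_lt wS; pose H := {x : G | x \in (~: S)%SET}.
pose e : rel H := @edge (delete_vertices S).
have esym : connect_sym e by apply: sym_connect_sym => x y; exact: edge_sym.
have HP (u : G) : u \notin S -> u \in (~: S)%SET by rewrite inE.
pose w' : H := Sub w (HP w wS).
pose c (u : G) : G :=
  if (insub u : option H) is Some x then val (fingraph.root e x) else u.
have cE (x : H) : c (val x) = val (fingraph.root e x) by rewrite /c valK.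
pose A := [set x : H | (x \in fingraph.roots e) && (x != fingraph.root e w')]%SET.
have pA : (p <= #|A|)%N.
  move: p_lt; rewrite /ncomponents /n_comp_mem.
  rewrite [X in (p < X)%N](cardD1 (fingraph.root e w')).
  move=> /leq_trans/(_ (leq_add (leq_b1 _) (leqnn _))).
  rewrite add1n ltnS => /leq_trans; apply.
  apply: subset_leq_card; apply/fintype.subsetP => x.
  by rewrite !inE andbT => /andP[-> ->].
have /card_geqP[s [s_uniq s_size sA]] := pA.
have cI x : x \in s -> c (val x) = val x.
  by move=> /sA; rewrite inE cE => /andP[/eqP ->].
exists [set val x | x in s]%SET, c; split.
- by rewrite card_imset ?(card_uniqP _) //; exact: val_inj.
- rewrite disjoint_subset; apply/fintype.subsetP => _ /imsetP[x _ ->].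
  by have := valP x; rewrite !inE.
- move=> u v uS vS uv.
  have -> : u = val (Sub u (HP u uS) : H) by [].
  have -> : v = val (Sub v (HP v vS) : H) by [].
  rewrite !cE; congr val; apply/(fingraph.rootP esym); exact: connect1.
- by move=> _ _ /imsetP[x xs ->] /imsetP[y ys ->]; rewrite !cI.
- move=> _ /imsetP[x xs ->]; rewrite cI // (_ : w = val w') // cE.
  by have := sA _ xs; rewrite inE => /andP[_]; apply: contra => /eqP/val_inj ->.
Qed.

(** * Isolating one vertex in each chosen component *)

Section Isolation.
Context {R : realType}.

Lemma quadratic_form_pairs (G : sgraph) (f : G -> R) :
  2 * quadratic_form G f
  = \sum_(e : G * G | edge e.1 e.2) (f e.1 + f e.2) ^+ 2.
Proof.
rewrite quadratic_form_edges pair_big /= [RHS]big_mkcond /=.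
by apply: eq_bigr => e _; case: edge; rewrite ?mul1r ?mul0r.
Qed.

(** Distinct edges of G are charged to distinct edges of H carrying at least as large a square; the
    remaining edges of H contribute nonnegative terms. *)
Lemma quadratic_form_inj_le (G H : sgraph) (f : G -> R) (g : H -> R)
    (s : G * G -> H * H) :
  {in [pred e | edge e.1 e.2] &, injective s} ->
  (forall e, edge e.1 e.2 -> edge (s e).1 (s e).2) ->
  (forall e, edge e.1 e.2 ->
     (f e.1 + f e.2) ^+ 2 <= (g (s e).1 + g (s e).2) ^+ 2) ->
  quadratic_form G f <= quadratic_form H g.
Proof.
move=> s_inj s_edge s_le.
rewrite -(ler_pM2l (_ : 0 < 2 :> R)) // !quadratic_form_pairs.
apply: le_trans (ler_sum _ s_le) _.
rewrite -(big_imset (fun e => (g e.1 + g e.2) ^+ 2) s_inj) /=.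
rewrite big_mkcond [leRHS]big_mkcond /=; apply: ler_sum => e _.
case: imsetP => [[d dG ->]|_]; first by rewrite s_edge.
by case: ifP; rewrite ?sqr_ge0.
Qed.

Lemma quadratic_form_mono (G H : sgraph) (f : G -> R) (g : H -> R)
    (h : G -> H) : injective h ->
  (forall u v, edge u v -> edge (h u) (h v)) -> (forall u, g (h u) = f u) ->
  quadratic_form G f <= quadratic_form H g.
Proof.
move=> h_inj hom gh.
apply: (quadratic_form_inj_le _ _ _ _ (fun e => (h e.1, h e.2))).
- by move=> [u v] [u' v'] _ _ [/h_inj -> /h_inj ->].
- by move=> e; apply: hom.
- by move=> e _; rewrite /= !gh.
Qed.

(* The edges that G has at a vertex v of I outside S are traded for edges at
   w: an edge uv becomes uw, and f w is maximal. *)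
Lemma quadratic_form_split (G : sgraph) (S I : {set G}) (c : G -> G) (w : G)
    (f : G -> R) :
  [disjoint I & S] ->
  (forall u v, u \notin S -> v \notin S -> edge u v -> c u = c v) ->
  {in I &, injective c} -> (forall v, v \in I -> c v != c w) ->
  w \notin S -> (forall u, 0 <= f u) -> (forall u, u \notin S -> f u <= f w) ->
  quadratic_form G f <= quadratic_form (split_graph S I) f.
Proof.
move=> dIS c_edge c_inj c_w wS f_ge0 f_le.
have IS v : v \in I -> v \notin S by move=> vI; rewrite (disjointFr dIS).
have wI : w \notin I by apply/negP => /c_w; rewrite eqxx.
pose T u := (u \notin S) && (u \notin I).
pose s (e : G * G) : G * G := if T e.1 && (e.2 \in I) then (e.1, w)
  else if T e.2 && (e.1 \in I) then (w, e.2) else e.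
have cI u v : u \notin S -> v \in I -> edge u v -> c u = c v.
  by move=> uS vI; apply: c_edge => //; exact: IS.
(* u lies in the component of v, which is not that of w; hence the new edge uw is not an edge of
   G. *)
have nadj u v : u \notin S -> v \in I -> edge u v -> ~~ edge u w && (u != w).
  move=> uS vI uv; have := c_w _ vI; rewrite -(cI u v) // => cuw.
  apply/andP; split; last by apply: contraNneq cuw => ->.
  by apply: contra cuw => uw; rewrite (c_edge u w).
apply: (@quadratic_form_inj_le G (split_graph S I) f f s).
(* Injectivity: a traded edge is not an edge of G, so it differs from every untraded one; two traded
   edges with the same image come from vertices of I in the same component, hence equal. *)
- move=> [u v] [u' v']; rewrite !inE /s /= => uv uv'.
  case: ifP => [/andP[/andP[uS uI] vI]|_].
    have /andP[nuw uw] := nadj _ _ uS vI uv.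
    case: ifP => [/andP[/andP[uS' uI'] vI']|_].
      move=> [eu]; rewrite -eu in uv' *; congr (_, _).
      by apply: c_inj => //; rewrite -(cI u v) // -(cI u v').
    case: ifP => [_ [euw]|_ [eu ev]]; first by rewrite euw eqxx in uw.
    by rewrite eu ev uv' in nuw.
  case: ifP => [/andP[/andP[vS vI] uI]|_].
    rewrite edge_sym in uv; have /andP[nvw vw] := nadj _ _ vS uI uv.
    case: ifP => [_ [_ evw]|_]; first by rewrite evw eqxx in vw.
    case: ifP => [/andP[/andP[vS' vI'] uI']|_ [eu ev]]; last first.
      by rewrite ev eu edge_sym uv' in nvw.
    move=> [ev]; rewrite edge_sym -ev in uv'; rewrite ev; congr (_, _).
    by apply: c_inj => //; rewrite -(cI v u) // -(cI v u').
  case: ifP => [/andP[/andP[uS' uI'] vI']|_].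
    have /andP[nuw _] := nadj _ _ uS' vI' uv'.
    by move=> [eu ev]; rewrite -eu -ev uv in nuw.
  case: ifP => [/andP[/andP[vS' vI'] uI']|_ //].
  rewrite edge_sym in uv'; have /andP[nvw _] := nadj _ _ vS' uI' uv'.
  by move=> [eu ev]; rewrite -eu -ev edge_sym uv in nvw.
- move=> [u v]; rewrite /= => uv; rewrite /s /=.
  case: ifPn => [/andP[/andP[uS uI] vI]|nuv].
    have /andP[_ uw] := nadj _ _ uS vI uv.
    by rewrite /= /split_edge uw uI wI !orbT.
  case: ifPn => [/andP[/andP[vS vI] uI]|nvu].
    rewrite edge_sym in uv; have /andP[_ vw] := nadj _ _ vS uI uv.
    by rewrite /= /split_edge eq_sym vw vI wI !orbT.
  have uv' : u != v by apply: contraTneq uv => ->; rewrite edge_irr.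
  rewrite /= /split_edge uv'; have [//|uS] := boolP (u \in S).
  have [//|vS] := boolP (v \in S); move: nuv nvu; rewrite /T uS vS /=.
  have [uI|//] := boolP (u \in I); have [vI _ _|//] := boolP (v \in I).
  by rewrite (c_inj u v) ?eqxx // in uv'; exact: c_edge.
- move=> [u v]; rewrite /= => uv; rewrite /s /= lerXn2r ?nnegrE ?addr_ge0 //.
  case: ifP => [/andP[_ vI]|_]; first by rewrite lerD2l f_le // IS.
  by case: ifP => [/andP[_ uI]|_]; rewrite ?lerD2r ?f_le // IS.
Qed.

(** The Perron vector of G serves as test vector for the split graph. The set S1 allows S to be
    enlarged to the size prescribed by the extremal graph, and the last clause turns equality of the
    indices into equality of the graphs. *)
Lemma q_index_le_split (G : sgraph) (S : {set G}) (p : nat) :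
  connected_graph G -> (p < ncomponents (delete_vertices S))%N ->
  exists I : {set G}, [/\ #|I| = p, [disjoint I & S] &
    forall S1 : {set G}, S \subset S1 ->
      q_index R G <= q_index R (split_graph S1 I) /\
      (q_index R (split_graph S1 I) <= q_index R G ->
       @edge G =2 @edge (split_graph S1 I))].
Proof.
move=> Gconn p_lt.
have [w0 w0S] : exists w, w \notin S.
  apply/existsP; apply: contraTT p_lt => /existsPn noS.
  rewrite -leqNgt /ncomponents /n_comp_mem eq_card0 // => x.
  by have := valP x; rewrite inE (negPf (noS _)).
have G_gt0 : (0 < #|G|)%N by apply/card_gt0P; exists w0.
have [f [f_ge0 f_neq0 fq]] := perron_vector (R := R) G G_gt0.
have f_gt0 := perron_vector_gt0 G f _ Gconn f_ge0 f_neq0 fq.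
have [w wS w_max] : exists2 w, w \notin S & forall u, u \notin S -> f u <= f w.
  have [w wS w_max] := @arg_maxP _ _ _ w0 (fun u => u \notin S) f w0S.
  by exists w.
have [I [c [Ip dIS c_edge c_inj c_w]]] := component_transversal G S p w p_lt wS.
clear p_lt.
exists I; split; [exact: Ip | exact: dIS | move=> S1 SS1].
have wI : w \notin I by apply/negP => /c_w; rewrite eqxx.
have IS v : v \in I -> v \notin S by move=> vI; rewrite (disjointFr dIS).
have SS1P u : u \in S -> u \in S1 by exact/fintype.subsetP.
set H := split_graph S1 I.
have GH : quadratic_form G f <= quadratic_form H f.
  apply: le_trans (quadratic_form_split G S I c w f _ _ _ _ _ _ _) _ => //.
  apply: (quadratic_form_mono _ _ _ _ (id : split_graph S I -> H)) => //.
  move=> u v /andP[uv /or3P[uS|vS|/andP[uI vI]]]; apply/andP; split=> //.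
  - by rewrite SS1P.
  - by rewrite [v \in S1]SS1P ?orbT.
  - by rewrite uI vI !orbT.
have sq_gt0 : 0 < \sum_u f u ^+ 2.
  rewrite (bigD1 w) //= ltr_pwDl ?exprn_gt0 //.
  by apply: sumr_ge0 => u _; exact: sqr_ge0.
(* Otherwise [//] unfolds the two spectral radii to compare them. *)
have := q_index_rayleigh H f; have := rayleigh_eq_eigen H f.
move: (q_index R H) (q_index R G) fq => qH qG fq eigH rayH.
have fqG : quadratic_form G f = qG * \sum_u f u ^+ 2.
  by rewrite mulr_sumr; apply: eq_bigr => u _; rewrite fq mulrCA -expr2.
have qGH : qG <= qH by rewrite -(ler_pM2r sq_gt0) -fqG; exact: le_trans GH rayH.
split=> // qHG.
have qE : qH = qG by apply/le_anti/andP.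
have fqH : quadratic_form H f = qH * \sum_u f u ^+ 2.
  by apply/le_anti/andP; split; rewrite // qE -fqG.
have adjw v : @edge G w v -> @edge H w v.
  move=> wv; apply/andP; split.
    by apply: contraTneq wv => ->; rewrite edge_irr.
  have [/SS1P ->|vS] := boolP (v \in S); first by rewrite orbT.
  rewrite wI; suff -> : v \notin I by rewrite !orbT.
  by apply/negP => /c_w; rewrite (c_edge w v) // eqxx.
have weightE (J : finType) (a b : pred J) (g : J -> R) :
    (forall j, a j -> b j) -> (forall j, 0 < g j) ->
    \sum_j (a j)%:R * g j = \sum_j (b j)%:R * g j -> a =1 b.
  move=> ab g_gt0 /eqP; rewrite eq_sym -subr_eq0 -sumrB psumr_eq0.
    move=> /allP h j; have := h j (mem_index_enum j); rewrite /= -mulrBl.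
    rewrite mulf_eq0 (gt_eqF (g_gt0 j)) orbF subr_eq0 eqr_nat.
    by case: (a j) (b j) => [] [].
  move=> j _; rewrite -mulrBl mulr_ge0 ?(ltW (g_gt0 j)) // subr_ge0 ler_nat.
  by case: (boolP (a j)) => // /ab ->.
(* f satisfies the same eigenvalue equation at w in both graphs, edges of G at w are edges of H, and
   f is positive: nothing was gained at w. *)
have nbr_w : @edge G w =1 @edge H w.
  apply: (weightE _ _ _ (fun v => f w + f v)) => //.
    by move=> v; rewrite addr_gt0.
  have slE : signless H f w = signless G f w.
    by rewrite (eigH fqH) qE fq.
  exact: esym slE.
have subGH u v : @edge G u v -> @edge H u v.
  (* Such an edge xy is impossible: x lies in the component of y, hence is not adjacent to w in G,
     whereas H joins x to w. *)
  have half x y : x \notin S -> y \in I -> ~~ @edge G x y.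
    move=> xS yI; apply/negP => xy; have cxy := c_edge x y xS (IS _ yI) xy.
    have cxw : c x != c w by rewrite cxy c_w.
    have xI : x \notin I.
      apply/negP => xI; have := c_inj x y xI yI cxy => exy.
      by rewrite exy edge_irr in xy.
    have : @edge G w x.
      rewrite nbr_w; apply/andP; split; last by rewrite wI xI !orbT.
      by apply: contraNneq cxw => ->.
    by move=> wx; rewrite (c_edge w x) ?eqxx in cxw.
  move=> uv; apply/andP; split; first by apply: contraTneq uv => ->; rewrite edge_irr.
  have [/SS1P -> //|uS] := boolP (u \in S).
  have [/SS1P ->|vS] := boolP (v \in S); first by rewrite orbT.
  have -> : u \notin I.
    by apply: contraTN uv => uI; rewrite edge_sym; exact: half.
  suff -> : v \notin I by rewrite !orbT.
  by apply: contraTN uv; exact: half.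
(* G is now a subgraph of H with the same quadratic form at a positive vector, so no edge can be
   missing. *)
have pairs : 2 * quadratic_form G f = 2 * quadratic_form H f.
  by rewrite fqG fqH qE.
move: pairs; rewrite !quadratic_form_edges !pair_big /= => pairs u v.
apply: (weightE _ (fun e : G * G => edge e.1 e.2)
  (fun e : G * G => @edge H e.1 e.2) (fun e => (f e.1 + f e.2) ^+ 2) _ _ _ (u, v)).
- by move=> e; exact: subGH.
- by move=> e; rewrite exprn_gt0 ?addr_gt0.
- exact: pairs.
Qed.

End Isolation.

(** * Identification with the extremal graph *)

Lemma isomorphic_sym (G H : sgraph) : isomorphic G H -> isomorphic H G.
Proof.
move=> [f [[g fK gK] fE]]; exists g; split; first by exists f.
by move=> x y; rewrite -fE !gK.
Qed.

Lemma isomorphic_q_index (R : realType) (G H : sgraph) : (0 < #|G|)%N ->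
  isomorphic G H -> q_index R G = q_index R H.
Proof.
move=> G_gt0 [f [[g fK gK] fE]].
have H_gt0 : (0 < #|H|)%N by rewrite -(bij_eq_card (Bijective fK gK)).
apply/le_anti/andP; split.
  by apply: (q_index_hom_le _ _ f) => // [|u v]; [exists g | rewrite fE].
by apply: (q_index_hom_le _ _ g) => // [|u v]; [exists f | rewrite -fE !gK].
Qed.

Lemma split_graph_extremal (V : finType) (S I : {set V}) (l b : nat) :
  [disjoint I & S] -> #|S| = ((l - 1) %/ b)%N -> #|I| = (l - 1)%N ->
  (0 < l)%N -> ((l - 1) %/ b + l <= #|V|)%N ->
  isomorphic (split_graph S I) (extremal_graph #|V| l b).
Proof.
move=> dIS cS cI l_gt0 le_n; apply: isomorphic_sym.
pose T := (~: (S :|: I))%SET.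
(* The lower bound on |V| keeps the truncated subtraction exact: one vertex fewer and the right side
   would still be 1 with T empty. *)
have cT : #|T| = (#|V| - (l - 1) %/ b - l + 1)%N.
  have := cardsC (S :|: I)%SET; rewrite -/T cardsU cS cI.
  by rewrite finset.setIC (disjoint_setI0 dIS) cards0; lia.
pose h (x : extremal_graph #|V| l b) : split_graph S I :=
  match x with
  | inl i => enum_val (cast_ord (esym cS) i)
  | inr (inl j) => enum_val (cast_ord (esym cT) j)
  | inr (inr (k, _)) => enum_val (cast_ord (esym cI) k)
  end.
have hS i : h (inl i) \in S by exact: enum_valP.
have hT j : h (inr (inl j)) \in T by exact: enum_valP.
have hI k : h (inr (inr k)) \in I by case: k => k o; exact: enum_valP.
have nSI u : u \in I -> u \in S = false by move=> uI; rewrite (disjointFr dIS).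
have nST u : u \in T -> u \in S = false.
  by rewrite !inE negb_or => /andP[/negPf].
have nIT u : u \in T -> u \in I = false.
  by rewrite !inE negb_or => /andP[_ /negPf].
have h_inj : injective h.
  have neq u v (A : {set V}) : u \in A -> v \in A = false -> u <> v.
    by move=> uA + uv; rewrite -uv uA.
  move=> [i|[j|k]] [i'|[j'|k']] e.
  - by rewrite (cast_ord_inj (enum_val_inj e)).
  - by case: (neq _ _ _ (hS i) (nST _ (hT j'))).
  - by case: (neq _ _ _ (hS i) (nSI _ (hI k'))).
  - by case: (neq _ _ _ (hS i') (nST _ (hT j))).
  - by rewrite (cast_ord_inj (enum_val_inj e)).
  - by case: (neq _ _ _ (hI k') (nIT _ (hT j))).
  - by case: (neq _ _ _ (hS i') (nSI _ (hI k))).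
  - by case: (neq _ _ _ (hI k) (nIT _ (hT j'))).
  - case: k k' e => [k o] [k' o'] e.
    by rewrite (cast_ord_inj (enum_val_inj e)) (ord1 o) (ord1 o').
exists h; split.
  apply: inj_card_bij h_inj _.
  rewrite /= !card_sum card_prod !card_ord.
  by have := max_card (mem I); rewrite cI; move: le_n; set m := #|V|; lia.
have hE u v : (h u != h v) = (u != v) by rewrite (inj_eq h_inj).
move=> x y; rewrite /= /split_edge hE.
case: x y => [i|[j|k]] [i'|[j'|k']].
- by rewrite hS andbT.
- by rewrite hS.
- by rewrite hS.
- by rewrite hS orbT.
- by rewrite !(nST _ (hT _)) !(nIT _ (hT _)) andbT.
- by rewrite (nST _ (hT _)) (nSI _ (hI _)) hI andbF.
- by rewrite hS orbT.
- by rewrite (nST _ (hT _)) (nSI _ (hI _)) hI andbF.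
- rewrite !(nSI _ (hI _)) !hI andbF.
  case: k k' => [k o] [k' o'].
  by rewrite /= /copies_edge /= /complete_edge (ord1 o) (ord1 o') eqxx andbF.
Qed.

Lemma subset_card_between (T : finType) (A B : {set T}) (k : nat) :
  A \subset B -> (#|A| <= k <= #|B|)%N ->
  exists C : {set T}, [/\ A \subset C, C \subset B & #|C| = k].
Proof.
move=> AB /andP[Ak kB].
have /card_geqP[s [s_uniq s_size sBA]] : (k - #|A| <= #|B :\: A|)%N.
  by rewrite cardsD (finset.setIidPr AB) leq_sub2r.
exists (A :|: [set x in s])%SET; split; first exact: finset.subsetUl.
  rewrite finset.subUset AB; apply/fintype.subsetP => x; rewrite inE => /sBA.
  by rewrite inE => /andP[].
rewrite cardsU cardsE (card_uniqP s_uniq) s_size.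
have -> : (A :&: [set x in s])%SET = finset.set0.
  apply/finset.setP => x; rewrite !inE; apply/negP => /andP[xA /sBA].
  by rewrite inE xA.
by rewrite cards0 subn0 subnKC.
Qed.

(** * Many isolated vertices *)

Section LargeSeparator.
Context {R : realType}.

(** This is the signless Laplacian of a clique on A: u has |A| - 1 neighbours there, and completing
    the sum over A by f u costs one more, whence the -2. *)
Lemma sum_adjacent (V : finType) (A : {set V}) (f : V -> R) (u : V) : u \in A ->
  \sum_v ((u != v) && (v \in A))%:R * (f u + f v)
  = (#|A|%:R - 2) * f u + \sum_(v in A) f v.
Proof.
move=> uA.
have -> : \sum_v ((u != v) && (v \in A))%:R * (f u + f v)
        = \sum_(v in A) (f u + f v) - 2 * f u.
  rewrite [\sum_(v in A) _]big_mkcond /= (bigD1 u) //= eqxx mul0r add0r.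
  rewrite [in RHS](bigD1 u) //= uA (_ : f u + f u = 2 * f u); last by ring.
  rewrite addrC addrK; apply: eq_bigr => v vu; rewrite eq_sym vu /=.
  by case: ifP; rewrite ?mul1r ?mul0r.
by rewrite big_split /= sumr_const -mulr_natl; ring.
Qed.

(** The test vector is the indicator of C, whose signless Laplacian is at least 2 (|C| - 1) on C. *)
Lemma q_index_clique (G : sgraph) (C : {set G}) : (0 < #|C|)%N ->
  {in C &, forall u v, u != v -> edge u v} ->
  2 * (#|C|%:R - 1) <= q_index R G.
Proof.
move=> C_gt0 clique; pose f u : R := (u \in C)%:R.
have sq : \sum_u f u ^+ 2 = #|C|%:R.
  rewrite -sum1_card natr_sum [RHS]big_mkcond /=; apply: eq_bigr => u _.
  by rewrite /f; case: (u \in C); rewrite ?expr1n ?expr0n.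
have cR : 0 < #|C|%:R :> R by rewrite ltr0n.
rewrite -(ler_pM2r cR) -[X in _ <= _ * X]sq.
apply: le_trans (q_index_rayleigh G f).
rewrite -[X in _ * X <= _]sq mulr_sumr; apply: ler_sum => u _.
rewrite /f; have [uC|uC] := boolP (u \in C); last by rewrite expr0n mulr0 mul0r.
rewrite expr1n mulr1 mul1r.
have := sum_adjacent _ C (fun v => (v \in C)%:R) u uC; rewrite uC /=.
have -> : \sum_(v in C) (v \in C)%:R = #|C|%:R :> R.
  by rewrite -sum1_card natr_sum; apply: eq_bigr => v ->.
have -> : (#|C|%:R - 2) * 1 + #|C|%:R = 2 * (#|C|%:R - 1) :> R by ring.
move=> <-; rewrite /signless; apply: ler_sum => v _.
rewrite uC ler_wpM2r ?addr_ge0 // ler_nat.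
by case: (boolP (_ && _)) => // /andP[uv vC]; rewrite clique.
Qed.

(* Up to scaling, (1, y, z) is the Perron vector of a split graph with s
   dominating and P isolated vertices, T being the number of other vertices. *)
Lemma split_perron_absurd (n p s P T q y z : R) :
  12 <= n -> 6 * p <= n -> 1 <= p -> 1 <= s -> 2 * s <= P -> p + 1 <= P ->
  T = n - P - s -> 1 <= T -> 2 * (n - 1 - p) <= q -> 0 <= y -> 0 <= z ->
  q - n + 2 = s + T * y + P * z ->
  (q - (n - P) + 2) * y = s + T * y ->
  (q - s) * z = s ->
  T * (y + z) ^+ 2 <= p * (1 + z) ^+ 2 -> False.
Proof.
move=> n12 pn p1 s1 sP pP TE T1 qn y0 z0 eS eT eI ineq.
have y1 : y < 1.
  rewrite ltNge; apply/negP => y1.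
  have E : (q - 2 * n + 2 * P + 2 + s) * y = s by move: eT; rewrite TE; nra.
  have : q - 2 * n + 2 * P + 2 >= 2 by lra.
  by nra.
(* q >= 3 n / 2 because 6 p <= n and n >= 12, and s <= n / 3 because 3 s <= s + P < n; so q - s >= 7
   n / 6. *)
have z1 : z * (7 / 6 * n) <= s.
  rewrite -eI mulrC ler_wpM2r //; lra.
have z2 : z < 2 / 7.
  rewrite ltNge; apply/negP => z2.
  have : 2 / 7 * (7 / 6 * n) <= z * (7 / 6 * n) by rewrite ler_wpM2r //; lra.
  by lra.
have Ty : T * y >= n - 2 * p - s - P * z by lra.
(* [Ty] and T y < T give P - P z < 2 p <= n / 3, and z < 2 / 7 turns this into 5 P / 7 < n / 3. *)
have P1 : P < 7 / 15 * n.
  have : T * y < T by rewrite gtr_pMr //; lra.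
  have : P * z <= P * (2 / 7) by rewrite ler_wpM2l //; lra.
  by lra.
have Pz : P * z <= P / 5.
  have : P * z <= 7 / 15 * n * z by rewrite ler_wpM2r //; lra.
  by lra.
(* Since y < 1, y (1 + z) <= y + z, and the factor (1 + z)^2 cancels from [ineq]. *)
have Ty2 : T * y ^+ 2 <= p.
  have z_gt0 : 0 < (1 + z) ^+ 2 by rewrite exprn_gt0 //; lra.
  rewrite -(ler_pM2r z_gt0); apply: le_trans ineq.
  rewrite -mulrA ler_wpM2l //; first by lra.
  rewrite -exprMn lerXn2r ?nnegrE //; nra.
have TT : (T * y) ^+ 2 <= n / 6 * (n - P).
  have -> : (T * y) ^+ 2 = T * y ^+ 2 * T by ring.
  apply: (@le_trans _ _ (p * T)); first by rewrite ler_wpM2r //; lra.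
  by rewrite ler_pM //; lra.
have g : 2 / 3 * n - 7 / 10 * P <= T * y by lra.
have g0 : 0 <= 2 / 3 * n - 7 / 10 * P by lra.
(* With [TT] this yields 5/18 n^2 - 23/30 n P + 49/100 P^2 <= 0, whereas the left side is a positive
   combination of the three products that follow. *)
have : (2 / 3 * n - 7 / 10 * P) ^+ 2 <= (T * y) ^+ 2.
  by rewrite lerXn2r ?nnegrE //; lra.
have : 0 < (7 / 15 * n - P) * (4 / 7 * n - P).
  by rewrite mulr_gt0 //; lra.
have : 0 < n * (7 / 15 * n - P) by rewrite mulr_gt0 //; lra.
have : 0 < n * n by rewrite mulr_gt0 //; lra.
by lra.
Qed.

(** * Comparing two split graphs *)

Section Compare.
Variables (V : finType) (S0 S I0 I : {set V}).
Hypotheses (SS : S0 \subset S) (II : I0 \subset I) (dIS : [disjoint I & S]).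

(** The neighbours of u are all other vertices, all others outside I, or S, according to its class.
    The right-hand sides do not depend on u, so f is constant on each class whose factor is
    nonzero. *)
Lemma split_perron_values (f : V -> R) (q : R) :
  (forall u, signless (split_graph S I) f u = q * f u) ->
  [/\ {in S, forall u, (q - #|V|%:R + 2) * f u = \sum_v f v},
      forall u, u \notin S -> u \notin I ->
        (q - (#|V|%:R - #|I|%:R) + 2) * f u = \sum_(v | v \notin I) f v
    & {in I, forall u, (q - #|S|%:R) * f u = \sum_(v in S) f v}].
Proof.
move=> fq; split=> u.
- move=> uS; have := sum_adjacent _ [set: V]%SET f u (finset.in_setT u).
  rewrite cardsT [\sum_(v in _) _](eq_bigl xpredT); last first.
    by move=> v; rewrite inE.
  move=> E.
  have : q * f u = (#|V|%:R - 2) * f u + \sum_v f v.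
    rewrite -fq -E; apply: eq_bigr => v _.
    by rewrite /= /split_edge uS finset.in_setT.
  by move=> E'; rewrite -(addKr ((#|V|%:R - 2) * f u) (\sum_v f v)) -E'; ring.
- move=> uS uI; have uC : u \in (~: I)%SET by rewrite inE.
  have := sum_adjacent _ _ f u uC.
  rewrite [\sum_(v in _) _](eq_bigl (fun v => v \notin I)); last first.
    by move=> v; rewrite inE.
  move=> E.
  have cC : #|(~: I)%SET|%:R = #|V|%:R - #|I|%:R :> R.
    by rewrite -(cardsC I) natrD addrC addKr.
  rewrite cC in E.
  have : q * f u = (#|V|%:R - #|I|%:R - 2) * f u + \sum_(v | v \notin I) f v.
    rewrite -fq -E; apply: eq_bigr => v _.
    rewrite /= /split_edge (negPf uS) uI inE /=.
    by have [vS|//] := boolP (v \in S); rewrite (disjointFl dIS vS).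
  move=> E'; rewrite -(addKr ((#|V|%:R - #|I|%:R - 2) * f u) (\sum_(v | _) f v)).
  by rewrite -E'; ring.
- move=> uI; have uS : u \in S = false by rewrite (disjointFr dIS).
  have : q * f u = #|S|%:R * f u + \sum_(v in S) f v.
    rewrite -fq mulr_natl -sumr_const -big_split /= [RHS]big_mkcond /=.
    apply: eq_bigr => v _; rewrite /= /split_edge uS uI /= orbF.
    have [vS|vS] := boolP (v \in S); last by rewrite andbF mul0r.
    by rewrite andbT (_ : u != v) ?mul1r //; apply: contraFneq uS => ->.
  by move=> E; rewrite mulrBl E addrC addKr.
Qed.

(* Passing from the first split graph to the second gains the edges between
   I \ I0 and the rest, and loses those between S \ S0 and I0. *)
Lemma split_edge_exchange (u v : V) :
  (split_edge S I u v + ((u \in I :\: I0) && (v \in ~: (S :|: I)))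
    + ((u \in ~: (S :|: I)) && (v \in I :\: I0))
  <= split_edge S0 I0 u v + ((u \in S :\: S0) && (v \in I0))
    + ((u \in I0) && (v \in S :\: S0)))%SET%N.
Proof.
rewrite /split_edge !inE.
have S0S x : (x \in S0) ==> (x \in S) by apply/implyP/fintype.subsetP.
have I0I x : (x \in I0) ==> (x \in I) by apply/implyP/fintype.subsetP.
have IS x : (x \in I) ==> (x \notin S).
  by apply/implyP => xI; rewrite (disjointFr dIS).
case: eqVneq => [<-|_].
  move: (S0S u) (I0I u) (IS u).
  by case: (u \in S0) (u \in S) (u \in I0) (u \in I) => [] [] [] [].
move: (S0S u) (I0I u) (IS u) (S0S v) (I0I v) (IS v).
by case: (u \in S0) (u \in S) (u \in I0) (u \in I)
         (v \in S0) (v \in S) (v \in I0) (v \in I) =>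
  [] [] [] [] [] [] [] [].
Qed.

Lemma sum_between (A B : {set V}) (f : V -> R) (a b : R) :
  {in A, forall u, f u = a} -> {in B, forall u, f u = b} ->
  \sum_u \sum_v ((u \in A) && (v \in B))%:R * (f u + f v) ^+ 2
  = #|A|%:R * #|B|%:R * (a + b) ^+ 2.
Proof.
move=> fA fB; rewrite -mulrA [RHS]mulr_natl -sumr_const [RHS]big_mkcond /=.
apply: eq_bigr => u _; have [uA|uA] := boolP (u \in A); last first.
  by rewrite big1 // => v _; rewrite mul0r.
rewrite mulr_natl -sumr_const [RHS]big_mkcond /=; apply: eq_bigr => v _.
by have [vB|vB] := boolP (v \in B); rewrite ?mul0r // mul1r fA // fB.
Qed.

(** Let f be the Perron vector of the first graph, with values x, y, z on S, T, I. The second graph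
    gains at least |I \ I0| |T| (y + z)^2 and loses |S \ S0| |I0| (x + z)^2. If its index were not
    larger, the gain would not exceed the loss, and |S| - |S0| <= |I| - |I0| would leave |T| (y +
    z)^2 <= |I0| (x + z)^2, which [split_perron_absurd] refutes. *)
Lemma q_index_split_lt :
  (12 <= #|V|)%N -> (6 * #|I0| <= #|V|)%N -> (0 < #|I0|)%N ->
  (#|S0| < #|S|)%N -> (2 * #|S| <= #|I|)%N ->
  (#|S| - #|S0| <= #|I| - #|I0|)%N -> (#|S| + #|I| < #|V|)%N ->
  q_index R (split_graph S I) < q_index R (split_graph S0 I0).
Proof.
move=> n12 p0n p0_gt0 s0s sP da sPn; rewrite ltNge; apply/negP => qHF.
set n := #|V| in n12 p0n sPn; set p := #|I0| in p0n p0_gt0 da.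
set s := #|S| in s0s sP da sPn; set P := #|I| in sP da sPn.
have pP : (p < P)%N by lia.
have d0 : (0 < s - #|S0|)%N by rewrite subn_gt0.
have sn : (s <= n)%N by lia.
have Pns : (P <= n - s)%N by lia.
have pn : (p < n)%N by lia.
have n_gt0 : (0 < n)%N by lia.
pose T := (~: (S :|: I))%SET.
have cT : #|T| = (n - s - P)%N.
  have := cardsC (S :|: I)%SET; rewrite -/T cardsU.
  by rewrite finset.setIC (disjoint_setI0 dIS) cards0 -/n -/s -/P; lia.
have nR : 12 <= n%:R :> R by rewrite ler_nat.
have pR : 6 * p%:R <= n%:R :> R by rewrite -natrM ler_nat.
have sR : 2 * s%:R <= P%:R :> R by rewrite -natrM ler_nat.
have sPR : s%:R + P%:R + 1 <= n%:R :> R by rewrite -natrD natr1 ler_nat.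
have pPR : p%:R + 1 <= P%:R :> R by rewrite natr1 ler_nat.
have p1R : 1 <= p%:R :> R by rewrite ler1n.
have s1R : 1 <= s%:R :> R by rewrite ler1n; exact: leq_ltn_trans s0s.
have TR : #|T|%:R = n%:R - P%:R - s%:R :> R.
  by rewrite cT !natrB //; ring.
have q_ge : 2 * (n%:R - 1 - p%:R) <= q_index R (split_graph S0 I0).
  have cC : #|(~: I0)%SET| = (n - p)%N by rewrite /n -(cardsC I0) addKn.
  rewrite (_ : n%:R - 1 - p%:R = #|(~: I0)%SET|%:R - 1); last first.
    by rewrite cC natrB 1?ltnW //; ring.
  apply: (q_index_clique (split_graph S0 I0)); first by rewrite cC subn_gt0.
  move=> u v; rewrite !inE => uI vI uv.
  by rewrite /= /split_edge uv uI vI !orbT.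
have [f [f_ge0 f_neq0 fq]] := perron_vector (R := R) (split_graph S I) n_gt0.
have rayH := q_index_rayleigh (split_graph S0 I0) f.
move: (q_index R (split_graph S I)) (q_index R (split_graph S0 I0))
  qHF q_ge fq rayH => q qH qHF q_ge fq rayH.
have [fS fT fI] := split_perron_values f q fq.
rewrite -/n -/s -/P in fS fT fI.
(* The lower bound on q makes the three factors of [split_perron_values] positive. *)
have q1 : 0 < q - n%:R + 2 by lra.
have q2 : 0 < q - (n%:R - P%:R) + 2 by lra.
have q3 : 0 < q - s%:R by lra.
pose x := (\sum_v f v) / (q - n%:R + 2).
pose y := (\sum_(v | v \notin I) f v) / (q - (n%:R - P%:R) + 2).
pose z := (\sum_(v in S) f v) / (q - s%:R).
have fx : {in S, forall u, f u = x}.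
  by move=> u uS; rewrite /x -(fS u uS) mulrC mulKf ?gt_eqF.
have fy : {in T, forall u, f u = y}.
  move=> u; rewrite !inE negb_or => /andP[uS uI].
  by rewrite /y -(fT u uS uI) mulrC mulKf ?gt_eqF.
have fz : {in I, forall u, f u = z}.
  by move=> u uI; rewrite /z -(fI u uI) mulrC mulKf ?gt_eqF.
have x_gt0 : 0 < x.
  rewrite divr_gt0 // lt_neqAle sumr_ge0 // andbT eq_sym.
  have [w fw] := f_neq0; apply: contra fw; rewrite psumr_eq0 //.
  by move=> /allP/(_ w (mem_index_enum w)).
have y_ge0 : 0 <= y by rewrite divr_ge0 ?sumr_ge0 // ltW.
have z_ge0 : 0 <= z by rewrite divr_ge0 ?sumr_ge0 // ltW.
have sumS : \sum_(v in S) f v = s%:R * x.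
  by rewrite (eq_bigr (fun=> x)) // sumr_const mulr_natl.
have sumI : \sum_(v in I) f v = P%:R * z.
  by rewrite (eq_bigr (fun=> z)) // sumr_const mulr_natl.
have sumT : \sum_(v in T) f v = #|T|%:R * y.
  by rewrite (eq_bigr (fun=> y)) // sumr_const mulr_natl.
have sumC : \sum_(v | v \notin I) f v = s%:R * x + #|T|%:R * y.
  rewrite (bigID (mem S)) /= -sumS -sumT; congr (_ + _); apply: eq_bigl => v.
    have [vS|] := boolP (v \in S); last by rewrite andbF.
    by rewrite (disjointFl dIS vS).
  by rewrite !inE negb_or andbC.
have sumV : \sum_v f v = s%:R * x + #|T|%:R * y + P%:R * z.
  by rewrite (bigID (mem I)) /= sumI sumC addrC.
have eS : (q - n%:R + 2) * x = s%:R * x + #|T|%:R * y + P%:R * z.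
  by rewrite -sumV /x mulrC divfK ?gt_eqF.
have eT : (q - (n%:R - P%:R) + 2) * y = s%:R * x + #|T|%:R * y.
  by rewrite -sumC /y mulrC divfK ?gt_eqF.
have eI : (q - s%:R) * z = s%:R * x.
  by rewrite -sumS /z mulrC divfK ?gt_eqF.
have exch : #|T|%:R * (y + z) ^+ 2 <= p%:R * (x + z) ^+ 2.
  pose D := (S :\: S0)%SET; pose A := (I :\: I0)%SET.
  have cD : #|D| = (s - #|S0|)%N by rewrite cardsD (finset.setIidPr SS).
  have cA : #|A| = (P - p)%N by rewrite cardsD (finset.setIidPr II).
  have fD : {in D, forall u, f u = x}.
    by move=> u; rewrite inE => /andP[_ /fx].
  have fA : {in A, forall u, f u = z}.
    by move=> u; rewrite inE => /andP[_ /fz].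
  have fI0 : {in I0, forall u, f u = z}.
    by move=> u /(fintype.subsetP II)/fz.
  have HF : quadratic_form (split_graph S0 I0) f
         <= quadratic_form (split_graph S I) f.
    apply: le_trans rayH _; apply: (@le_trans _ _ (q * \sum_u f u ^+ 2)).
      by rewrite ler_wpM2r // sumr_ge0 // => u _; exact: sqr_ge0.
    rewrite mulr_sumr; apply: ler_sum => u _.
    by rewrite fq expr2 mulrCA.
  have : \sum_u \sum_v ((split_edge S I u v)%:R * (f u + f v) ^+ 2
      + ((u \in A) && (v \in T))%:R * (f u + f v) ^+ 2
      + ((u \in T) && (v \in A))%:R * (f u + f v) ^+ 2)
    <= \sum_u \sum_v ((split_edge S0 I0 u v)%:R * (f u + f v) ^+ 2
      + ((u \in D) && (v \in I0))%:R * (f u + f v) ^+ 2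
      + ((u \in I0) && (v \in D))%:R * (f u + f v) ^+ 2).
    apply: ler_sum => u _; apply: ler_sum => v _.
    rewrite -!mulrDl ler_wpM2r ?sqr_ge0 // -!natrD ler_nat.
    exact: split_edge_exchange.
  under eq_bigr do rewrite !big_split /=.
  under [leRHS]eq_bigr do rewrite !big_split /=.
  rewrite !big_split /=.
  rewrite !(sum_between _ _ f _ _ fA fy) !(sum_between _ _ f _ _ fy fA).
  rewrite !(sum_between _ _ f _ _ fD fI0) !(sum_between _ _ f _ _ fI0 fD).
  have := quadratic_form_edges (split_graph S I) f => /= <-.
  have := quadratic_form_edges (split_graph S0 I0) f => /= <-.
  rewrite -/p cD cA => ineq.
  have d_gt0 : 0 < (s - #|S0|)%N%:R :> R by rewrite ltr0n.
  have daR : (s - #|S0|)%N%:R <= (P - p)%N%:R :> R by rewrite ler_nat.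
  rewrite -(ler_pM2l d_gt0).
  have t0 : 0 <= #|T|%:R * (y + z) ^+ 2 by rewrite mulr_ge0 // sqr_ge0.
  have := ler_wpM2r t0 daR.
  lra.
have xu : x != 0 by rewrite gt_eqF.
apply: (@split_perron_absurd n%:R p%:R s%:R P%:R #|T|%:R q (y / x) (z / x)) => //.
- by rewrite TR; lra.
- exact: le_trans q_ge qHF.
- by rewrite divr_ge0 // ltW.
- by rewrite divr_ge0 // ltW.
- by apply: (mulIf xu); rewrite eS; field.
- by rewrite mulrA eT; field.
- by rewrite mulrA eI; field.
- have -> : y / x + z / x = (y + z) / x by field.
  have -> : 1 + z / x = (x + z) / x by field.
  by rewrite !exprMn (mulrA #|T|%:R) (mulrA p%:R) ler_wpM2r ?sqr_ge0.
Qed.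

End Compare.
End LargeSeparator.

(** * Small and large separators violating the toughness bound *)

Theorem theorem1p2 (R : realType) (b l n : nat) (G : sgraph) :
  (2 <= b)%N -> (2 <= l)%N ->
  connected_graph G -> #|G| = n ->
  (6 * b * ceil_div (l - 1) b <= n)%N ->
  q_index R (extremal_graph n l b) <= q_index R G ->
  ~ isomorphic G (extremal_graph n l b) ->
  ((b%:R^-1)%:E <= toughness R l G)%E.
Proof.
move=> b2 l2 Gconn Gn n_ge qHG notH.
rewrite /toughness; case: ifP => _; last exact: leey.
elim/big_ind: _ => [|x y bx by_|S lS]; first exact: leey.
  by rewrite le_min bx by_.
set c := ncomponents _ in lS *.
have c_gt0 : 0 < c%:R :> R by rewrite ltr0n (leq_trans _ lS) // ltnW.
have b_gt0 : 0 < b%:R :> R by rewrite ltr0n ltnW.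
rewrite lee_fin ler_pdivlMr // ler_pdivrMl // -natrM ler_nat leqNgt.
apply/negP => bsc.
set p := (l - 1)%N in n_ge; pose s0 := (p %/ b)%N.
have p_gt0 : (0 < p)%N by rewrite /p; lia.
have lp : l = p.+1 by rewrite /p; lia.
(* The rounded-up quotient is at least 1 and at least p / b, so the bound on n gives both n >= 12,
   as b >= 2, and n >= 6 p. *)
have [k_gt0 pk] : (0 < ceil_div p b)%N /\ (p <= b * ceil_div p b)%N.
  have pE := divn_eq p b; have r_lt : (p %% b < b)%N by rewrite ltn_mod; lia.
  rewrite /ceil_div /dvdn; case: eqP => [r0|_] /=.
    by rewrite r0 in pE; split; nia.
  by split; nia.
have n12 : (12 <= n)%N by nia.
have n6p : (6 * p <= n)%N by nia.
have ps0 : (p < b * s0.+1)%N by rewrite mulnC ltn_ceil //; lia.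
have s0p : (b * s0 <= p)%N by rewrite mulnC leq_divM.
have s0l : (s0 + l <= n)%N by nia.
have H_iso (S0 I0 : {set G}) : [disjoint I0 & S0] -> #|S0| = s0 -> #|I0| = p ->
    isomorphic (split_graph S0 I0) (extremal_graph n l b).
  by move=> dIS cS cI; rewrite -Gn; apply: split_graph_extremal; rewrite ?Gn //; lia.
have H_q (S0 I0 : {set G}) : [disjoint I0 & S0] -> #|S0| = s0 -> #|I0| = p ->
    q_index R (split_graph S0 I0) = q_index R (extremal_graph n l b).
  move=> dIS cS cI; apply: isomorphic_q_index; last exact: H_iso.
  by rewrite /= Gn; lia.
have [s_le|s_gt] := leqP #|S| s0.
  have pc : (p < c)%N by rewrite -lp.
  have [I [cI dIS sub]] := q_index_le_split (R := R) G S p Gconn pc.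
  (* S is enlarged to s0 vertices within the complement of I, so that the split graph becomes the
     extremal one. *)
  have SI : S \subset (~: I)%SET by rewrite -finset.disjoints_subset disjoint_sym.
  have cCI : (#|S| <= s0 <= #|(~: I)%SET|)%N.
    by rewrite s_le /= -(leq_add2l #|I|) cardsC cI Gn; lia.
  have [S1 [SS1 S1I cS1]] := subset_card_between _ _ _ _ SI cCI.
  have dIS1 : [disjoint I & S1].
    by rewrite disjoint_sym finset.disjoints_subset.
  have [_ GE] := sub S1 SS1.
  rewrite (H_q S1 I) // in GE; apply: notH.
  have [h [hbij hE]] := H_iso S1 I dIS1 cS1 cI.
  exists h; split; first exact: hbij.
  by move=> u v; rewrite hE; exact: esym (GE qHG u v).
(* The violation b |S| < c is exactly what permits b |S| isolated vertices. *)
have [I [cI dIS sub]] := q_index_le_split (R := R) G S (b * #|S|) Gconn bsc.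
have [qGF _] := sub S (subxx S).
have pI : (p <= #|I|)%N by rewrite cI; nia.
have le0I : (#|@finset.set0 G| <= p <= #|I|)%N by rewrite cards0.
have le0S : (#|@finset.set0 G| <= s0 <= #|S|)%N by rewrite cards0 (ltnW s_gt).
have [I0 [_ I0I cI0]] := subset_card_between _ _ _ _ (finset.sub0set I) le0I.
have [S0 [_ S0S cS0]] := subset_card_between _ _ _ _ (finset.sub0set S) le0S.
have dIS0 : [disjoint I0 & S0] by exact: disjointW I0I S0S dIS.
have c_le : (c <= #|(~: S)%SET|)%N.
  apply: leq_trans (max_card _) _; rewrite card_sig; apply: subset_leq_card.
  by apply/fintype.subsetP => u.
have := cardsC S; rewrite Gn => cSn.
have S2 : (2 * #|S| <= b * #|S|)%N by rewrite leq_mul2r b2 orbT.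
(* With d = |S| - s0 >= 1 and p <= b s0 + b - 1, the right side is at least b (d - 1) + 1 >= d. *)
have gain : (#|S| - s0 <= b * #|S| - p)%N by nia.
(* Each component of G - S has a vertex, so b |S| < c <= n - |S|; thus some vertex lies outside both
   S and I. *)
have Sn : (#|S| + b * #|S| < n)%N by lia.
move: qGF; rewrite leNgt => /negP; apply.
apply: lt_le_trans (q_index_split_lt G S0 S I0 I S0S I0I dIS _ _ _ _ _ _ _) _;
  rewrite ?Gn ?cI0 ?cS0 ?cI //.
by rewrite (H_q S0 I0).
Qed.
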